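(* Let $f:\mathbb{R}^n\to\mathbb{R}$ have a nonempty set of global minimizers $\mathcal{X}^*$, let $x_0\in\mathbb{R}^n$, and let $S=\{x\in\mathbb{R}^n : \mathrm{dist}(x;\mathcal{X}^* )\le \mathrm{dist}(x_0;\mathcal{X}^* )\}$. Suppose $f$ is locally Lipschitz over $S$ and that there exist $M>0$ and $\rho\ge 0$ such that, for all $x^*\in\mathcal{X}^*$ and $x\in S\setminus\mathcal{X}^*$, $$\|u\|\le M\quad\text{and}\quad f(x^* )\ge f(x)+\langle u,x^*-x\rangle-\frac{\rho}{2}\|x^*-x\|^2,\qquad\forall u\in\partial^\circ f(x)$$ ($\rho$-weak convexity with respect to $x^*$). Suppose also that there exists $m>0$ such that $f(x)-f(x^* )\ge m\|x-x^*\|$ for all $x^*\in\mathcal{X}^*$ and $x\in S\setminus\mathcal{X}^*$ (sharpness). If $\mathrm{dist}(x_0;\mathcal{X}^* )\le\frac{m}{\rho}$, then $$\bar{\mu}\ge\frac{m}{2M}>0,$$ where $$\bar{\mu}=\inf_{x^*\in\mathcal{X}^*,\ x\in S\setminus\mathcal{X}^*}\ \inf_{u\in\partial^\circ f(x)\setminus\{0\}}\frac{\langle u,x-x^*\rangle}{\|u\|\,\|x-x^*\|}$$ is the inverse condition number of $f$.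
   Context: $\|\cdot\|$ is the Euclidean norm and $\langle\cdot,\cdot\rangle$ the standard inner product on $\mathbb{R}^n$; $\mathrm{dist}(x;X)=\inf_{y\in X}\|x-y\|$. ''Locally Lipschitz over $S$'' means that every point of $S$ has an open neighborhood in $\mathbb{R}^n$ on which $f$ is Lipschitz. For $x\in S$, $\partial^\circ f(x)$ denotes the Clarke (generalized) subdifferential, i.e. $\partial^\circ f(x)=\{u\in\mathbb{R}^n : \langle u,v\rangle\le f^\circ(x;v)\ \forall v\in\mathbb{R}^n\}$ with $f^\circ(x;v)=\limsup_{y\to x,\ \lambda\downarrow 0}\frac{f(y+\lambda v)-f(y)}{\lambda}$. Conventions: an infimum over an empty set is $+\infty$, and $m/\rho=+\infty$ when $\rho=0$. *)

(* Defs.v *)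
From HB Require Import structures.
From mathcomp Require Import all_boot all_order all_algebra.
From mathcomp Require Import all_classical all_reals all_analysis.
Set Implicit Arguments.
Unset Strict Implicit.
Unset Printing Implicit Defensive.
Import Order.TTheory GRing.Theory Num.Theory.
Import numFieldNormedType.Exports.
Local Open Scope classical_set_scope.
Local Open Scope ring_scope.

Section Defs.
Variables (R : realType) (n : nat).
Implicit Types (f : 'rV[R]_n -> R) (x v : 'rV[R]_n) (X S : set 'rV[R]_n).

Definition dot x v : R := \sum_(i < n) x 0 i * v 0 i.

(* The library norm `|x| on 'rV[R]_n is the sup norm, so the Euclidean norm is
   defined here; both norms induce the library's topology on 'rV[R]_n. *)
Definition enorm x : R := Num.sqrt (dot x x).

Definition dist x X : \bar R := ereal_inf [set (enorm (x - y))%:E | y in X].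

Definition minimizers f : set 'rV[R]_n := [set x | forall y, f x <= f y].

Definition sublevel_dist f x0 : set 'rV[R]_n :=
  [set x | (dist x (minimizers f) <= dist x0 (minimizers f))%E].

Definition locally_lipschitz_over f S :=
  forall x, S x -> exists U : set 'rV[R]_n, [/\ open U, U x &
    exists L : R, forall y z, U y -> U z -> `|f y - f z| <= L * enorm (y - z)].

(* The pair p is (y, lambda), with y -> x (y = x allowed) and lambda -> 0+. *)
Definition clarke_dd f x v : \bar R :=
  limf_esup
    (fun p : 'rV[R]_n * R => ((f (p.1 + p.2 *: v) - f p.1) / p.2)%:E)
    (filter_prod (nbhs x) (at_right (0 : R))).

Definition clarke_subdiff f x : set 'rV[R]_n :=
  [set u | forall v, ((dot u v)%:E <= clarke_dd f x v)%E].

(* Infima are taken in \bar R, where ereal_inf set0 = +oo. *)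
Definition inv_cond_number f x0 : \bar R :=
  let X := minimizers f in
  let S := sublevel_dist f x0 in
  ereal_inf [set
    (let: (xs, x) := p in
     ereal_inf [set (dot u (x - xs) / (enorm u * enorm (x - xs)))%:E
               | u in clarke_subdiff f x `\ 0])
    | p in X `*` (S `\` X)].

End Defs.

(* Main.v *)
Require Import Defs.
From HB Require Import structures.
From mathcomp Require Import all_boot all_order all_algebra.
From mathcomp Require Import all_classical all_reals all_analysis.
From mathcomp Require Import ring lra.
Set Implicit Arguments.
Unset Strict Implicit.
Unset Printing Implicit Defensive.
Import Order.TTheory GRing.Theory Num.Theory.
Import numFieldNormedType.Exports.
Local Open Scope classical_set_scope.
Local Open Scope ring_scope.

(** Sharpness is assumed with respect to every minimizer, not only the nearest
    one, and this forces the minimizer to be unique as soon as S contains a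
    point x that is not a minimizer.  Indeed the set of minimizers is closed,
    because f is continuous on S, so the segment from a minimizer to x leaves
    it at some last point b ([exists_boundary_point]).  Points y that are not
    minimizers accumulate at b and eventually lie in S; for any minimizer xs
    the bound m |y - xs| <= f y - f xs = f y - f b tends, as y tends to b,
    to m |b - xs| <= 0, so xs = b ([minimizer_unique]).

    Consequently |x - xs| is the distance from x to the minimizers, which is at
    most m / rho ([weak_modulus_le_sharpness]).  Adding the weak convexity
    inequality to sharpness gives, for d = |x - xs| and a subgradient u,
    <u, x - xs> >= m d - rho d^2 / 2 >= m d / 2, and dividing by |u| d <= M d
    yields the bound m / (2 M). *)

Section Euclidean.
Variables (R : realType) (n : nat).
Implicit Types (x y v : 'rV[R]_n) (X : set 'rV[R]_n).

Lemma dotNr x v : dot x (- v) = - dot x v.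
Proof. by rewrite /dot -sumrN; apply: eq_bigr => i _; rewrite mxE mulrN. Qed.

Lemma dot_ge0 x : 0 <= dot x x.
Proof. by apply: sumr_ge0 => i _; rewrite -expr2 sqr_ge0. Qed.

Lemma enorm_ge0 x : 0 <= enorm x.
Proof. exact: sqrtr_ge0. Qed.

Lemma enormZ (t : R) x : enorm (t *: x) = `|t| * enorm x.
Proof.
rewrite /enorm; suff -> : dot (t *: x) (t *: x) = t ^+ 2 * dot x x.
  by rewrite sqrtrM ?sqr_ge0// sqrtr_sqr.
rewrite /dot mulr_sumr; apply: eq_bigr => i _; rewrite !mxE; ring.
Qed.

Lemma enormB x y : enorm (x - y) = enorm (y - x).
Proof. by rewrite -opprB -scaleN1r enormZ normrN1 mul1r. Qed.

(** Triangle inequalities below are taken in the sup norm, so this comparison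
    stands in for the Cauchy-Schwarz inequality. *)
Lemma norm_le_enorm x : `|x| <= enorm x.
Proof.
rewrite [`|x|]mx_normrE; apply/bigmax_leP; split; first exact: enorm_ge0.
move=> [i j] _ /=; rewrite (ord1 i) -sqrtr_sqr ler_sqrt ?dot_ge0//.
rewrite /dot (bigD1 j)//= -expr2 lerDl.
by apply: sumr_ge0 => k _; rewrite -expr2 sqr_ge0.
Qed.

Lemma enorm_gt0 x : x != 0 -> 0 < enorm x.
Proof. by rewrite -normr_gt0 => /lt_le_trans; apply; exact: norm_le_enorm. Qed.

Lemma dist_ge0 x X : (0 <= dist x X)%E.
Proof. by apply: le_ereal_inf_tmp => _ [y _ <-]; rewrite lee_fin enorm_ge0. Qed.

Lemma dist_le_enorm x y X : X y -> (dist x X <= (enorm (x - y))%:E)%E.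
Proof. by move=> Xy; apply: ereal_inf_lbound; exists y. Qed.

Lemma dist_set1 x y : dist x [set y] = (enorm (x - y))%:E.
Proof. by rewrite /dist image_set1 ereal_inf1. Qed.

Lemma dist_lt_ex x X (e : R) :
  (dist x X < e%:E)%E -> exists2 y, X y & enorm (x - y) < e.
Proof. by move=> /ereal_inf_lt[_ [y Xy <-]]; rewrite lte_fin; exists y. Qed.

(** The boundary point is the last point of X on the segment from a to c. *)
Lemma exists_boundary_point X a c :
  (forall p, (dist p X <= 0)%E -> X p) -> X a -> ~ X c ->
  exists2 b, X b & forall e, 0 < e -> exists2 y, ~ X y & enorm (y - b) < e.
Proof.
move=> Xcl Xa Xc.
pose g (t : R) := a + t *: (c - a).
have gB s t : enorm (g s - g t) = `|s - t| * enorm (c - a).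
  by rewrite -enormZ /g opprD addrACA subrr add0r scalerBl.
pose T := [set t : R | [/\ 0 <= t, t <= 1 & X (g t)]].
have T0 : T 0 by split; rewrite ?ler01// /g scale0r addr0.
have supT : has_sup T by split; [exists 0|exists 1 => t []].
set s := sup T.
have s_ge0 : 0 <= s by apply: (ub_le_sup supT.2).
have s_le1 : s <= 1 by apply: (ge_sup supT.1) => t [].
have d0 : 0 < enorm (c - a) + 1 by rewrite ltr_wpDl ?enorm_ge0.
have dle k e : 0 <= k -> k < e / (enorm (c - a) + 1) ->
    k * enorm (c - a) < e.
  move=> k0; rewrite ltr_pdivlMr// => /(le_lt_trans _); apply.
  by rewrite ler_wpM2l// lerDl.
have Xb : X (g s).
  apply: Xcl; apply/lee_addgt0Pr => e e0; rewrite add0e.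
  have [t Tt ts] := sup_adherent (divr_gt0 e0 d0) supT.
  have ts' : t <= s by apply: (ub_le_sup supT.2).
  apply: le_trans (dist_le_enorm _ _) _; first by case: Tt => _ _; exact.
  rewrite lee_fin gB ger0_norm ?subr_ge0//.
  by apply/ltW/dle; rewrite ?subr_ge0//; move: ts; rewrite -/s; lra.
have s_lt1 : s < 1.
  rewrite lt_neqAle s_le1 andbT; apply/eqP => s1; apply: Xc.
  by move: Xb; rewrite s1 /g scale1r addrC subrK.
exists (g s) => // e e0.
(* The step past s is halved for strictness and capped to stay in [0, 1]. *)
pose k := Num.min (1 - s) (e / (enorm (c - a) + 1) / 2).
have q0 := divr_gt0 e0 d0.
have k_gt0 : 0 < k by rewrite lt_min subr_gt0 s_lt1 divr_gt0.
have k_le1 : k <= 1 - s by rewrite ge_min lexx.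
have k_lt : k < e / (enorm (c - a) + 1).
  rewrite gt_min; apply/orP; right; lra.
exists (g (s + k)); last first.
  by rewrite gB [s + k]addrC addrK gtr0_norm// dle// ltW.
move=> Xk; suff : s + k <= s by lra.
by apply: (ub_le_sup supT.2); split=> //; lra.
Qed.

End Euclidean.

Section Minimizers.
Variables (R : realType) (n : nat) (f : 'rV[R]_n -> R) (x0 : 'rV[R]_n).
Hypothesis hlip : locally_lipschitz_over f (sublevel_dist f x0).

Let X := minimizers f.
Let S := sublevel_dist f x0.

Lemma lipschitz_at p : S p -> exists r L, [/\ 0 < r, 0 < L &
  forall y, enorm (y - p) < r -> `|f y - f p| <= L * enorm (y - p)].
Proof.
move=> /hlip[U [Uo Up [L UL]]].
have /nbhs_ballP[r /= r0 rU] : nbhs p U by exact: open_nbhs_nbhs.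
exists r, (`|L| + 1); split; rewrite ?ltr_wpDl// => y yr.
apply: le_trans (UL _ _ _ Up) _.
  apply: rU; rewrite -ball_normE /ball_/=.
  by apply: le_lt_trans (norm_le_enorm _) _; rewrite enormB.
rewrite ler_wpM2r ?enorm_ge0//.
by apply: le_trans (ler_norm L) _; rewrite lerDl.
Qed.

Lemma minimizers_eq a b : X a -> X b -> f a = f b.
Proof. by move=> Xa Xb; apply/eqP; rewrite eq_le Xa Xb. Qed.

(** A point at distance 0 from the minimizers lies in S whatever x0 is, so f is
    Lipschitz near it and takes the minimal value there. *)
Lemma minimizers_closed p : (dist p X <= 0)%E -> X p.
Proof.
move=> p0.
have Sp : S p by apply: le_trans p0 (dist_ge0 _ _).
have [r [L [r0 L0 fL]]] := lipschitz_at Sp.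
move=> z; apply/ler_addgt0Pr => e e0.
have [] := @dist_lt_ex _ _ p X (Num.min r (e / L)).
  by apply: le_lt_trans p0 _; rewrite lte_fin lt_min r0 divr_gt0.
move=> y Xy; rewrite enormB lt_min => /andP[yr].
rewrite ltr_pdivlMr// mulrC => yL.
have := le_lt_trans (fL _ yr) yL.
by have := Xy z; rewrite ltr_norml => ? /andP[]; lra.
Qed.

(** Near the boundary point b, f y - f b is of order |y - b|, whereas sharpness
    at another minimizer ys would keep it above a value close to m |b - ys|. *)
Lemma minimizer_unique (m : R) : 0 < m ->
  (forall xs x, X xs -> (S `\` X) x -> m * enorm (x - xs) <= f x - f xs) ->
  forall x xs, (S `\` X) x -> X xs -> X = [set xs].
Proof.
move=> m0 hsharp x xs [Sx Xx] Xxs.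
(* If x0 were at distance 0, S would reduce to the closed set X. *)
have x0_gt0 : (0 < dist x0 X)%E.
  rewrite ltNge; apply/negP => x00; apply: Xx.
  by apply: minimizers_closed; apply: le_trans Sx x00.
have [b Xb bP] := exists_boundary_point minimizers_closed Xxs Xx.
have Sb : S b.
  apply: le_trans (dist_le_enorm b Xb) _.
  by rewrite subrr -[0](scale0r 0) enormZ normr0 mul0r dist_ge0.
have [r [L [r0 L0 fL]]] := lipschitz_at Sb.
have [d [d0 dx0]] : exists d : R, 0 < d /\ (d%:E <= dist x0 X)%E.
  have := dist_le_enorm x0 Xb; case: (dist x0 X) x0_gt0 => [d| |]//.
  by rewrite lte_fin => d0 _; exists d.
suff eqb ys : X ys -> ys = b.
  by rewrite (eqb _ Xxs); apply/seteqP; split=> [y /eqb|y ->].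
move=> Xys; apply/eqP; rewrite eq_sym -subr_eq0 -normr_le0.
apply/ler_addgt0Pr => e e0; rewrite add0r.
(* The factor 1 + L / m collects |b - y| and |y - ys| <= L |y - b| / m. *)
have K0 : 0 < 1 + L / m by rewrite addr_gt0// divr_gt0.
have [|y Xy] := bP (Num.min (Num.min r d) (e / (1 + L / m))).
  by rewrite !lt_min r0 d0 divr_gt0.
rewrite !lt_min => /andP[/andP[yr yd]]; rewrite ltr_pdivlMr// => ye.
have Sy : S y.
  apply: le_trans (dist_le_enorm y Xb) (le_trans _ dx0).
  by rewrite lee_fin ltW.
have yys : enorm (y - ys) <= L / m * enorm (y - b).
  rewrite -mulrA mulrCA ler_pdivlMl//.
  apply: le_trans (hsharp _ _ Xys (conj Sy Xy)) _.
  rewrite (minimizers_eq Xys Xb); exact: le_trans (ler_norm _) (fL _ yr).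
rewrite -[b](subrK y) -addrA.
apply: le_trans (ler_normD _ _) _.
have := norm_le_enorm (b - y); have := norm_le_enorm (y - ys).
rewrite (enormB b y); lra.
Qed.

(** Uniqueness turns the distance bound on x0 into a bound on |x - xs|. *)
Lemma weak_modulus_le_sharpness (m rho : R) : 0 < m -> 0 <= rho ->
  (forall xs x, X xs -> (S `\` X) x -> m * enorm (x - xs) <= f x - f xs) ->
  (dist x0 X <= m%:E / rho%:E)%E ->
  forall x xs, (S `\` X) x -> X xs -> rho * enorm (x - xs) <= m.
Proof.
move=> m0 rho0 hsharp hdist x xs SXx Xxs.
have := le_trans SXx.1 hdist; rewrite -/X.
rewrite (minimizer_unique m0 hsharp SXx Xxs) dist_set1.
have [-> _|rho_neq0] := eqVneq rho 0; first by rewrite mul0r ltW.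
rewrite inver (negbTE rho_neq0) -EFinM lee_fin ler_pdivlMr 1?mulrC//.
by rewrite lt_def rho_neq0.
Qed.

End Minimizers.

(* m%:E / rho%:E is division in \bar R, which is +oo when rho = 0 < m. *)
Theorem lemma4 (R : realType) (n : nat) (f : 'rV[R]_n -> R) (x0 : 'rV[R]_n)
  (M rho m : R)
  (hX : minimizers f !=set0)
  (hlip : locally_lipschitz_over f (sublevel_dist f x0))
  (hM : 0 < M) (hrho : 0 <= rho)
  (hweak : forall xs x : 'rV[R]_n,
     minimizers f xs -> (sublevel_dist f x0 `\` minimizers f) x ->
     forall u : 'rV[R]_n, clarke_subdiff f x u ->
       enorm u <= M /\
       f x + dot u (xs - x) - rho / 2 * enorm (xs - x) ^+ 2 <= f xs)
  (hm : 0 < m)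
  (hsharp : forall xs x : 'rV[R]_n,
     minimizers f xs -> (sublevel_dist f x0 `\` minimizers f) x ->
     m * enorm (x - xs) <= f x - f xs)
  (hdist : (dist x0 (minimizers f) <= m%:E / rho%:E)%E) :
  ((m / (2 * M))%:E <= inv_cond_number f x0)%E /\ 0 < m / (2 * M).
Proof.
have mM0 : 0 < m / (2 * M) by rewrite divr_gt0// mulr_gt0.
split=> //; apply: le_ereal_inf_tmp => _ [[xs x] [/= Xxs SXx] <-].
apply: le_ereal_inf_tmp => _ [u [du /eqP u0] <-].
have rho_le := weak_modulus_le_sharpness hlip hm hrho hsharp hdist SXx Xxs.
have [uM hw] := hweak _ _ Xxs SXx _ du.
have hs := hsharp _ _ Xxs SXx.
have x_neq : x - xs != 0.
  by rewrite subr_eq0; apply/eqP => xE; apply: SXx.2; rewrite xE.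
have dgt0 := enorm_gt0 x_neq; have ugt0 := enorm_gt0 u0.
rewrite -[xs - x]opprB dotNr opprB enormB in hw.
set d := enorm (x - xs) in rho_le hs dgt0 hw *.
rewrite lee_fin ler_pdivlMr ?mulr_gt0//.
have half : m / 2 * d <= dot u (x - xs).
  have : rho * d * d <= m * d by rewrite ler_wpM2r// ltW.
  lra.
apply: le_trans half; rewrite mulrA ler_wpM2r ?(ltW dgt0)//.
suff -> : m / 2 = m / (2 * M) * M by rewrite ler_wpM2l// ltW.
by field; rewrite gt_eqF.
Qed.
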